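(* Let $\Bbbk$ be an algebraically closed field of characteristic zero and let $B=[b_{rs}]$ be an $n\times 2$ integer matrix of rank $2$ with rows $b_1,\dots,b_n$. Let $I(B)=\langle x^{\mu_+}-x^{\mu_-} \mid \mu \text{ a column of } B\rangle\subseteq \Bbbk[x_1,\dots,x_n]$. Suppose that $b_i$ and $b_j$ ($i\neq j$) are linearly dependent rows of $B$ lying in opposite open quadrants of $\mathbb{Z}^2$, and without loss of generality assume $b_{i1},b_{i2}>0$. Let $d=\gcd(b_{i1},b_{i2})$ and write $\lambda=-b_{j1}/b_{i1}=-b_{j2}/b_{i2}>0$. Then the primary component of $I(B)$ corresponding to the associated prime $\langle x_i,x_j\rangle$ is \[ \Big(I(B):\big(\textstyle\prod_{k\neq i,j}x_k\big)^\infty\Big)+\big\langle x_j^{\lambda(b_{i1}+b_{i2}-d)},\ x_i^{d}x_j^{\lambda(b_{i1}+b_{i2}-2d)},\ x_i^{2d}x_j^{\lambda(b_{i1}+b_{i2}-3d)},\ \dots,\ x_i^{b_{i1}+b_{i2}-d}\big\rangle . \] Moreover, the only monomials in this ideal are those in $\langle x_j^{\lambda(b_{i1}+b_{i2}-d)}, x_i^{d}x_j^{\lambda(b_{i1}+b_{i2}-2d)},\dots,x_i^{b_{i1}+b_{i2}-d}\rangle$.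
   Context: For $\mu\in\mathbb{Z}^n$, $\mu_+,\mu_-\in\mathbb{N}^n$ are defined by $(\mu_+)_k=\max(\mu_k,0)$, $(\mu_-)_k=\max(-\mu_k,0)$, so $\mu=\mu_+-\mu_-$; $x^u=x_1^{u_1}\cdots x_n^{u_n}$. The monomial generators are $x_i^{kd}x_j^{\lambda(b_{i1}+b_{i2}-(k+1)d)}$ for $k=0,1,\dots,(b_{i1}+b_{i2}-d)/d$. $(J:f^\infty)$ denotes the saturation $\{g \mid f^m g\in J \text{ for some } m\}$. *)

(* Defs.v *)
From HB Require Import structures.
From mathcomp Require Import all_boot all_order all_algebra.
From mathcomp Require Import mpoly.
Set Implicit Arguments. Unset Strict Implicit. Unset Printing Implicit Defensive.
Import Order.TTheory GRing.Theory Num.Theory.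
Local Open Scope ring_scope.

Section Ideals.
Variables (n : nat) (K : comRingType).
Local Notation P := {mpoly K[n]}.

Definition ideal_gen (S : P -> Prop) : P -> Prop :=
  fun f => exists l : seq (P * P),
    (forall p, p \in l -> S p.2) /\ f = \sum_(p <- l) p.1 * p.2.

Definition ideal_sum (I J : P -> Prop) : P -> Prop :=
  fun h => exists f g, I f /\ J g /\ h = f + g.

Definition saturation (I : P -> Prop) (f : P) : P -> Prop :=
  fun g => exists m : nat, I (f ^+ m * g).

Definition radical (I : P -> Prop) : P -> Prop :=
  fun f => exists m : nat, I (f ^+ m).

Definition is_primary (J : P -> Prop) : Prop :=
  ~ J 1 /\ forall f g, J (f * g) -> J f \/ exists m : nat, J (g ^+ m).

(* J is the primary component of I for the (minimal) associated prime Q: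
   J is Q-primary and J = I R_Q ∩ R = { f | s f ∈ I for some s ∉ Q }. *)
Definition primary_component (I Q J : P -> Prop) : Prop :=
  [/\ is_primary J,
      (forall f, radical J f <-> Q f)
    & (forall f, J f <-> exists s, ~ Q s /\ I (s * f))].

Definition pos_part (mu : 'I_n -> int) : 'X_{1..n} :=
  [multinom `|Num.max (mu k) 0|%N | k < n].
Definition neg_part (mu : 'I_n -> int) : 'X_{1..n} :=
  [multinom `|Num.max (- mu k) 0|%N | k < n].

Definition binom (mu : 'I_n -> int) : P := 'X_[pos_part mu] - 'X_[neg_part mu].

Definition lattice_basis_ideal (B : 'M[int]_(n, 2)) : P -> Prop :=
  ideal_gen (fun f => exists c : 'I_2, f = binom (fun k => B k c)).

End Ideals.

(* Main.v *)
(* Put d = gcd(b_i1, b_i2), (b_i1, b_i2) = d(p, q), l = lambda d, X = x_i^d and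
   Z = x_j^l.  The generators of I(B) are m1 X^p - n1 Z^p and m2 X^q - n2 Z^q,
   with m1, n1, m2, n2 monomials in the other variables, and the added monomials
   are the X^k Z^(p+q-1-k).

   On monomials of (X, Z)-degree p + q - 1, the two binomials are the edges of a
   graph on Z/(p+q), from k to k + p, which is a cycle since p and q are coprime.
   Going once around it multiplies each such monomial by w = n1^q m2^p - m1^q n2^p
   modulo I(B), and w <> 0 because B has rank 2: locally at <x_i, x_j> these
   monomials are in I(B).

   In degree < p + q - 1 the graph is a cycle with a vertex removed, hence a
   path.  Following the path, if a polynomial h without x_i, x_j divides
   A (m1 X^p - n1 Z^p) + B (m2 X^q - n2 Z^q) then it divides A and B, up to a
   monomial in the other variables.  So below degree p + q - 1 the
   quotient by the saturation has no torsion over the polynomials in the other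
   variables, which gives the primary component.  A monomial of low degree in the
   component would be in the saturation, which vanishes at (1, ..., 1). *)
Require Import Defs.
From HB Require Import structures.
From mathcomp Require Import all_boot all_order all_algebra.
From mathcomp Require Import mpoly zify ring.
Set Implicit Arguments. Unset Strict Implicit. Unset Printing Implicit Defensive.
Import Order.TTheory GRing.Theory Num.Theory.
Local Open Scope ring_scope.

(* Stepping by p in Z/(p+q) is stepping by -q; rk is the position along the cycle
   started at p + q - 1, the vertex left out. *)
Lemma path_rank (p q : nat) : coprime p q -> (0 < p)%N -> (0 < q)%N ->
  exists rk : nat -> nat,
    (forall k, (p <= k)%N -> (k < p + q - 1)%N -> (rk (k - p) < rk k)%N) /\
    (forall k, (k + q < p + q - 1)%N -> (rk (k + q) < rk k)%N).
Proof.
move=> cpq p0 q0; have co : coprime p (p + q) by rewrite /coprime gcdnDl.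
have [z zE] : exists z, (z * p = 1 %[mod p + q])%N.
  case: (egcdnP (p + q) p0) => u v uE _; exists u.
  by rewrite uE (eqP co) modnMDl.
(* [z] inverts [p] modulo [p + q], so [rk k] counts the steps of length [p] leading from [p + q - 1]
   to [k]; the successor gives that vertex rank 0. *)
pose rk k := (k.+1 * z %% (p + q))%N; exists rk.
have pos k : (k < p + q - 1)%N -> (0 < rk k)%N.
  move=> kl; rewrite lt0n; apply/negP => /eqP r0.
  have : (k.+1 = 0 %[mod p + q])%N.
    by rewrite -[k.+1]muln1 -modnMmr -zE modnMmr mulnA -modnMml -/(rk k) r0 mul0n.
  by rewrite mod0n modn_small; lia.
(* One step raises the rank by 1 modulo [p + q]. Wrapping around would give [b] rank 0, which only
   the omitted vertex has. *)
have step a b : (b < p + q - 1)%N -> (b.+1 * z = a.+1 * z + 1 %[mod p + q])%N ->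
    (rk a < rk b)%N.
  move=> /pos b0; rewrite -modnDml -/(rk a) -/(rk b) => E.
  rewrite -/(rk b) in b0; have := @ltn_pmod (a.+1 * z) (p + q).
  rewrite -/(rk a) => /(_ ltac:(lia)) al.
  have := @divn_eq (rk a + 1) (p + q); rewrite -E; move: b0 E.
  case: (ltnP (rk a + 1) (p + q)) => h.
    by rewrite modn_small // => b0; rewrite /rk => ->; rewrite -/(rk a); lia.
  have -> : (rk a + 1 = p + q)%N by lia.
  by rewrite modnn /rk => b0 E; move: b0; rewrite E.
split=> k h1.
  move=> h2; apply: step => //.
  have -> : k.+1 = ((k - p).+1 + p)%N by lia.
  by rewrite mulnDl -modnDmr [(p * z)%N]mulnC zE modnDmr.
apply: step; first lia.
(* A step of [p] from [k + q] lands on [k] modulo [p + q]. *)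
have : ((k + q).+1 * z + z * p = k.+1 * z + z * (p + q) %[mod p + q])%N by congr (_ %% _)%N; nia.
by rewrite -modnDmr zE modnDmr [in X in _ = X -> _]addnC modnMDl => ->.
Qed.

(** * Bivariate polynomials: truncation by weighted degree, divisibility in a localization *)

Section Bivariate.
Variable T : comNzRingType.
Implicit Types (G H : {poly {poly T}}) (h y : T).

Lemma bipolyP G H : (forall b a, G`_b`_a = H`_b`_a) -> G = H.
Proof. by move=> E; apply/polyP => b; apply/polyP => a. Qed.

(* The outer variable plays the role of x_j, the inner one that of x_i; the
   monomial with exponents (a, b) has (X, Z)-degree a %/ d + b %/ l. *)
Definition wtrunc (d l N : nat) G : {poly {poly T}} :=
  \poly_(b < size G) \poly_(a < size G`_b)
     (if (a %/ d + b %/ l < N)%N then G`_b`_a else 0).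

Lemma coef_wtrunc d l N G b a :
  (wtrunc d l N G)`_b`_a = if (a %/ d + b %/ l < N)%N then G`_b`_a else 0.
Proof.
rewrite /wtrunc coef_poly; case: ltnP => hb; last by rewrite [G`_b]nth_default // coef0 if_same.
by rewrite coef_poly; case: ltnP => // ha; rewrite [_`_a]nth_default ?if_same.
Qed.

Lemma coefCCM h G b a : (h%:P%:P * G)`_b`_a = h * G`_b`_a.
Proof. by rewrite !coefCM. Qed.

Lemma coefXXM r s G b a : ('X%:P ^+ r * 'X ^+ s * G)`_b`_a =
  if (r <= a)%N && (s <= b)%N then G`_(b - s)`_(a - r) else 0.
Proof.
rewrite -mulrA -rmorphXn /= coefCM !coefXnM !ltnNge.
by case: (leqP r a) => //= _; case: leqP; rewrite ?coef0.
Qed.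

Lemma wtruncD d l N : {morph wtrunc d l N : G H / G + H}.
Proof.
move=> G H; apply: bipolyP => b a; rewrite !(coef_wtrunc, coefD).
by case: ifP; rewrite ?addr0.
Qed.

Lemma wtrunc_id d l N G : wtrunc d l N (wtrunc d l N G) = wtrunc d l N G.
Proof. by apply: bipolyP => b a; rewrite !coef_wtrunc; case: (_ < _)%N. Qed.

Lemma wtruncCM d l N h G : wtrunc d l N (h%:P%:P * G) = h%:P%:P * wtrunc d l N G.
Proof.
by apply: bipolyP => b a; rewrite !(coef_wtrunc, coefCCM); case: ifP; rewrite ?mulr0.
Qed.

(** Exponents that are multiples of [d] and [l] pass through the floor divisions, so the degree
    shifts by exactly [r + s]. If [N < r + s], the truncated subtraction makes both sides vanish. *)
Lemma wtruncXXM d l N r s G : (0 < d)%N -> (0 < l)%N ->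
  wtrunc d l N ('X%:P ^+ (d * r) * 'X ^+ (l * s) * G) =
  'X%:P ^+ (d * r) * 'X ^+ (l * s) * wtrunc d l (N - (r + s)) G.
Proof.
move=> d0 l0; apply: bipolyP => b a; rewrite !(coefXXM, coef_wtrunc).
case: andP => [[ha hb]|_]; last by rewrite if_same.
have -> : (a %/ d = (a - d * r) %/ d + r)%N.
  by rewrite -{1}(subnK ha) addnC [(d * r)%N]mulnC divnMDl // addnC.
have -> : (b %/ l = (b - l * s) %/ l + s)%N.
  by rewrite -{1}(subnK hb) addnC [(l * s)%N]mulnC divnMDl // addnC.
move: (_ %/ d)%N (_ %/ l)%N => u v; congr (if _ then _ else _); lia.
Qed.

(** A generator of the lattice basis ideal, homogeneous of (X, Z)-degree [p], with the monomials in
    the other variables as constants. *)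
Definition biform (d l : nat) (m n : T) (p : nat) : {poly {poly T}} :=
  m%:P%:P * ('X%:P ^+ (d * p)) - n%:P%:P * 'X ^+ (l * p).

Lemma coef_biformM d l m n p G b a : (biform d l m n p * G)`_b`_a =
  (if (d * p <= a)%N then m * G`_b`_(a - d * p) else 0) -
  (if (l * p <= b)%N then n * G`_(b - l * p)`_a else 0).
Proof.
rewrite /biform mulrBl -!mulrA !coefB !coefCCM.
have := coefXXM (d * p) 0 G b a; rewrite expr0 mulr1 => ->.
have := coefXXM 0 (l * p) G b a; rewrite expr0 mul1r => ->.
by rewrite !leq0n !subn0 andbT /=; do 2![case: ifP => _]; rewrite ?mulr0.
Qed.

Lemma wtrunc_biformM d l m n p N G : (0 < d)%N -> (0 < l)%N ->
  wtrunc d l N (biform d l m n p * G) = biform d l m n p * wtrunc d l (N - p) G.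
Proof.
move=> d0 l0; rewrite /biform !mulrBl -!mulNr -!rmorphN -!mulrA wtruncD !wtruncCM.
have := wtruncXXM N p 0 G d0 l0; rewrite muln0 expr0 mulr1 addn0 => ->.
by have := wtruncXXM N 0 p G d0 l0; rewrite muln0 expr0 mul1r add0n => ->.
Qed.

(** Divisibility by [h] after inverting [y], written without fractions. *)
Definition dvd_upto y h (g : T) := exists e k, y ^+ e * g = h * k.

Lemma dvd_upto0 y h : dvd_upto y h 0.
Proof. by exists 0, 0; rewrite !mulr0. Qed.

Lemma dvd_uptoD y h f g : dvd_upto y h f -> dvd_upto y h g -> dvd_upto y h (f + g).
Proof.
move=> [e [k E]] [e' [k' E']]; exists (e + e')%N, (y ^+ e' * k + y ^+ e * k').
by rewrite exprD; ring: E E'.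
Qed.

Lemma dvd_uptoM y h f g : dvd_upto y h g -> dvd_upto y h (f * g).
Proof. by move=> [e [k E]]; exists e, (f * k); rewrite mulrCA E mulrCA. Qed.

Lemma dvd_uptoN y h g : dvd_upto y h g -> dvd_upto y h (- g).
Proof. by rewrite -mulN1r; apply: dvd_uptoM. Qed.

(** A divisor of a power of [y] is a unit once [y] is inverted. *)
Lemma dvd_upto_cancel y h m m' c g : m' * m = y ^+ c ->
  dvd_upto y h (m * g) -> dvd_upto y h g.
Proof.
move=> mE /(dvd_uptoM m'); rewrite mulrA mE => -[e [k E]].
by exists (e + c)%N, k; rewrite exprD -mulrA.
Qed.

(** Only finitely many coefficients are nonzero, so one exponent serves them all. *)
Lemma dvd_upto_lift y h G : (forall b a, dvd_upto y h G`_b`_a) ->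
  exists e H, (y ^+ e)%:P%:P * G = h%:P%:P * H.
Proof.
pose D G := exists e H, (y ^+ e)%:P%:P * G = h%:P%:P * H.
have D0 : D 0 by exists 0, 0; rewrite !mulr0.
have DD f g : D f -> D g -> D (f + g).
  move=> [e [k E]] [e' [k' E']].
  exists (e + e')%N, ((y ^+ e')%:P%:P * k + (y ^+ e)%:P%:P * k').
  by rewrite exprD !rmorphM; ring: E E'.
move=> hG; rewrite -/(D G) -[G]coefK poly_def.
elim/big_ind: _ => // b _; rewrite -[G`_b]coefK poly_def scaler_suml.
elim/big_ind: _ => // a _; have [e [k E]] := hG b a.
exists e, (k%:P%:P * ('X^a%:P * 'X^b)).
rewrite -mul_polyC -mul_polyC rmorphM !mulrA -!rmorphM /=.
by rewrite -E.
Qed.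

End Bivariate.

(* A coefficient of A or B is an edge of the path graph; comparing coefficients at
   the vertex it starts from expresses it by the previous edge and a multiple of h. *)
Lemma biform_torsion (T : idomainType) (d l p q : nat) (m1 n1 m2 n2 : T) (y h : T) (G A B : {poly {poly T}}) :
  (0 < d)%N -> (0 < l)%N -> coprime p q -> (0 < p)%N -> (0 < q)%N ->
  (exists c z, z * n1 = y ^+ c) -> (exists c z, z * m2 = y ^+ c) ->
  h != 0 ->
  h%:P%:P * wtrunc d l (p + q - 1) G = biform d l m1 n1 p * A + biform d l m2 n2 q * B ->
  exists e A' B', (y ^+ e)%:P%:P * wtrunc d l (p + q - 1) G =
     biform d l m1 n1 p * A' + biform d l m2 n2 q * B'.
Proof.
move=> d0 l0 cpq p0 q0 [cn [zn znE]] [cm [zm zmE]] h0 E.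
set W := wtrunc _ _ _ G in E *.
(* Homogeneity of the binomials allows [A] and [B] to be truncated as well, leaving only the edges
   between monomials of degree below [p + q - 1]. *)
have {}E : h%:P%:P * W = biform d l m1 n1 p * wtrunc d l (q - 1) A +
                         biform d l m2 n2 q * wtrunc d l (p - 1) B.
  have := congr1 (wtrunc d l (p + q - 1)) E.
  rewrite wtruncCM wtrunc_id wtruncD !wtrunc_biformM //.
  have -> : (p + q - 1 - p = q - 1)%N by lia.
  by have -> : (p + q - 1 - q = p - 1)%N by lia.
set A1 := wtrunc _ _ _ A in E; set B1 := wtrunc _ _ _ B in E.
have [rk [rk1 rk2]] := path_rank cpq p0 q0.
have divB x z w : (0 < x)%N -> (x * z <= w)%N -> ((w - x * z) %/ x = w %/ x - z)%N /\ (z <= w %/ x)%N.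
  move=> x0 xzw; split; last by rewrite leq_divRL // mulnC.
  by rewrite -{2}(subnK xzw) addnC [(x * z)%N]mulnC divnMDl // addnC addnK.
have divD x z w : (0 < x)%N -> ((w + x * z) %/ x = w %/ x + z)%N.
  by move=> x0; rewrite addnC mulnC divnMDl // addnC.
(* Induction on the rank of the vertex [u]. The two coefficients are the edges leaving [u], towards
   [u + p] and [u - q]; the edges arriving from [u - p] and [u + q] start at vertices of smaller
   rank. *)
have main : forall r a b u v, (a %/ d = u)%N -> (b %/ l = v)%N ->
   (rk u < r)%N -> (u + v < p + q - 1)%N ->
   ((l * p <= b)%N -> dvd_upto y h A1`_(b - l * p)`_a) /\
   ((d * q <= a)%N -> dvd_upto y h B1`_b`_(a - d * q)).
  elim=> // r IH a b u v au bv ra ab.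
  have := congr1 (fun F : {poly {poly T}} => F`_b`_a) E.
  rewrite /= !coefD coefCCM !coef_biformM => Eab.
  have t1 : dvd_upto y h (if (d * p <= a)%N then m1 * A1`_b`_(a - d * p) else 0).
    case: ifP => [ha|_]; last exact: dvd_upto0.
    have [] := divB _ _ _ d0 ha; rewrite au => q1 q2; apply: dvd_uptoM.
    have [|||| ] := IH (a - d * p)%N (b + l * p)%N (u - p)%N (v + p)%N.
    - exact: q1.
    - by rewrite divD // bv.
    - by apply: leq_trans (rk1 _ _ _) _; lia.
    - by lia.
    - by rewrite addnK leq_addl => /(_ isT).
  have t2 : dvd_upto y h (if (l * q <= b)%N then n2 * B1`_(b - l * q)`_a else 0).
    case: ifP => [hb|_]; last exact: dvd_upto0.
    have [] := divB _ _ _ l0 hb; rewrite bv => q1 q2; apply: dvd_uptoM.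
    have [|||| ] := IH (a + d * q)%N (b - l * q)%N (u + q)%N (v - q)%N.
    - by rewrite divD // au.
    - exact: q1.
    - by apply: leq_trans (rk2 _ _) _; lia.
    - by lia.
    - by rewrite addnK leq_addl => _ /(_ isT).
  have th : dvd_upto y h (h * W`_b`_a) by exists 0%N, W`_b`_a; rewrite expr0 mul1r.
  have := dvd_uptoD (dvd_uptoD th (dvd_uptoN t1)) t2.
  rewrite Eab; set u1 := (if _ then _ else _); set u2 := (if _ then _ else _).
  set u3 := (if _ then _ else _); set u4 := (if _ then _ else _) => t3.
  have {}t3 : dvd_upto y h (u3 - u2).
    by have -> : u3 - u2 = u1 - u2 + (u3 - u4) - u1 + u4 by ring.
  (* Two outgoing edges would need [p <= v] and [q <= u], against the degree bound. The only one
     left carries the factor [n1] or [m2], a unit once [y] is inverted. *)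
  split=> hh; move: t3; rewrite /u2 /u3 hh.
    have [_] := divB _ _ _ l0 hh; rewrite bv => h1.
    case: ifP => [h2|_]; first by have [_] := divB _ _ _ d0 h2; rewrite au; lia.
    rewrite sub0r => /dvd_uptoN; rewrite opprK; exact: dvd_upto_cancel znE.
  have [_] := divB _ _ _ d0 hh; rewrite au => h1.
  case: ifP => [h2|_]; first by have [_] := divB _ _ _ l0 h2; rewrite bv; lia.
  by rewrite subr0; exact: dvd_upto_cancel zmE.
have [|eA [A' AE]] := @dvd_upto_lift _ y h A1.
  move=> b a; rewrite /A1 coef_wtrunc; case: ifP => [hab|_]; last exact: dvd_upto0.
  (* The edge carried by this coefficient of [A1] starts at the monomial with exponents
     [(a, b + l * p)]. *)
  have [||||] := main (rk (a %/ d)%N).+1 a (b + l * p)%N (a %/ d)%N (b %/ l + p)%N; rewrite ?divD //.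
    by move: (_ %/ _)%N (_ %/ _)%N hab => u v; lia.
  by rewrite addnK leq_addl /A1 coef_wtrunc hab => /(_ isT).
have [|eB [B' BE]] := @dvd_upto_lift _ y h B1.
  move=> b a; rewrite /B1 coef_wtrunc; case: ifP => [hab|_]; last exact: dvd_upto0.
  have [||||] := main (rk (a %/ d + q)%N).+1 (a + d * q)%N b (a %/ d + q)%N (b %/ l)%N; rewrite ?divD //.
    by move: (_ %/ _)%N (_ %/ _)%N hab => u v; lia.
  by rewrite addnK leq_addl /B1 coef_wtrunc hab => _ /(_ isT).
exists (eA + eB)%N, ((y ^+ eB)%:P%:P * A'), ((y ^+ eA)%:P%:P * B').
apply: (@mulfI _ h%:P%:P); first by rewrite !polyC_eq0.
rewrite exprD !rmorphM /=.
transitivity ((y ^+ eA)%:P%:P * (y ^+ eB)%:P%:P * (h%:P%:P * W)); first by ring.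
by rewrite E; ring: AE BE.
Qed.

(** * Monomial exchange along the two binomials *)

Definition ideal_closed (R : comNzRingType) (I : R -> Prop) : Prop :=
  [/\ I 0, (forall f g, I f -> I g -> I (f + g)) & (forall r f, I f -> I (r * f))].

Lemma ideal_gen_closed (n : nat) (K : comNzRingType) (S : {mpoly K[n]} -> Prop) :
  ideal_closed (ideal_gen S).
Proof.
split.
- by exists [::]; split=> //; rewrite big_nil.
- move=> f g [l [lS ->]] [l' [lS' ->]]; exists (l ++ l'); split; last by rewrite big_cat.
  by move=> p; rewrite mem_cat => /orP[/lS|/lS'].
- move=> r f [l [lS ->]]; exists [seq (r * p.1, p.2) | p <- l]; split.
    by move=> _ /mapP[p /lS Sp ->].
  by rewrite big_map mulr_sumr; apply: eq_bigr => p _; rewrite mulrA.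
Qed.

Lemma ideal_genM (n : nat) (K : comNzRingType) (S : {mpoly K[n]} -> Prop) r f :
  S f -> ideal_gen S (r * f).
Proof.
move=> Sf; exists [:: (r, f)]; split; last by rewrite big_seq1.
by move=> p; rewrite inE => /eqP ->.
Qed.

Lemma ideal_gen_min (n : nat) (K : comNzRingType) (S J : {mpoly K[n]} -> Prop) f :
  ideal_closed J -> (forall g, S g -> J g) -> ideal_gen S f -> J f.
Proof.
move=> [J0 JD JM] SJ [l [lS ->]]; elim: l lS => [|p l IH] lS; first by rewrite big_nil.
rewrite big_cons; apply: JD; first by apply/JM/SJ/lS; rewrite mem_head.
by apply: IH => r rl; apply: lS; rewrite inE rl orbT.
Qed.

Lemma ideal_closed_sum (R : comNzRingType) (I : R -> Prop) (T : Type) (r : seq T) (F : T -> R) :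
  ideal_closed I -> (forall t, I (F t)) -> I (\sum_(t <- r) F t).
Proof. by move=> [I0 ID _] IF; elim/big_ind: _. Qed.

Lemma ideal_closedB (R : comNzRingType) (I : R -> Prop) f g :
  ideal_closed I -> I f -> I g -> I (f - g).
Proof. by move=> [_ ID IM] If /(IM (-1)); rewrite mulN1r; apply: ID. Qed.

(* U counts the steps from k to k + p, and D those from k to k - q. *)
Lemma cycle_walk (R : comNzRingType) (I : R -> Prop) (X Z m1 n1 m2 n2 : R) (p q : nat) :
  ideal_closed I -> I (m1 * X ^+ p - n1 * Z ^+ p) -> I (m2 * X ^+ q - n2 * Z ^+ q) ->
  (0 < p)%N -> (0 < q)%N ->
  forall a b m, (a + b = p + q - 1)%N -> exists U D a' b',
    [/\ (U + D = m)%N, (a' + b' = p + q - 1)%N, (a' + q * D = a + p * U)%N &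
     I (n1 ^+ U * m2 ^+ D * (X ^+ a * Z ^+ b) - m1 ^+ U * n2 ^+ D * (X ^+ a' * Z ^+ b'))].
Proof.
move=> Icl I1 I2 p0 q0 a b m ab; have [I0 ID IM] := Icl.
elim: m => [|m [U [D [a' [b' [UD ab' E IE]]]]]].
  by exists 0%N, 0%N, a, b; split; rewrite ?muln0 ?subrr.
(* A move always exists: [a' < q] forces [p <= b'], since [a' + b' = p + q - 1]. *)
have [aq|aq] := ltnP a' q.
  exists U.+1, D, (a' + p)%N, (b' - p)%N; split; [lia | lia | nia |].
  move: IE => /(IM n1) IE.
  move: I1 => /(IM (m1 ^+ U * n2 ^+ D * (X ^+ a' * Z ^+ (b' - p)))) I1.
  have := ideal_closedB Icl IE I1; congr I.
  have {1}-> : b' = (b' - p + p)%N by lia.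
  by rewrite !exprS !exprD; ring.
exists U, D.+1, (a' - q)%N, (b' + q)%N; split; [lia | lia | nia |].
move: IE => /(IM m2) IE.
move: I2 => /(IM (m1 ^+ U * n2 ^+ D * (X ^+ (a' - q) * Z ^+ b'))) I2.
have := ID _ _ IE I2; congr I.
have {1}-> : a' = (a' - q + q)%N by lia.
by rewrite !exprS !exprD; ring.
Qed.

Lemma cycle_mem (R : comNzRingType) (I : R -> Prop) (X Z m1 n1 m2 n2 : R) (p q a b : nat) :
  ideal_closed I -> I (m1 * X ^+ p - n1 * Z ^+ p) -> I (m2 * X ^+ q - n2 * Z ^+ q) ->
  (0 < p)%N -> (0 < q)%N -> (a + b = p + q - 1)%N ->
  I ((n1 ^+ q * m2 ^+ p - m1 ^+ q * n2 ^+ p) * (X ^+ a * Z ^+ b)).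
Proof.
move=> Icl I1 I2 p0 q0 ab.
have [U [D [a' [b' [UD ab' E IE]]]]] := cycle_walk Icl I1 I2 p0 q0 (p + q) ab.
(* With [U + D = p + q], the difference [a' - a] equals [(p + q)(U - q)]; both exponents being below
   [p + q], it is 0. *)
have Uq : U = q.
  have E2 : (a' + (p + q) * q = a + (p + q) * U)%N by nia.
  nia.
have Dp : D = p by lia.
have aa : a' = a by nia.
have bb : b' = b by lia.
by move: IE; rewrite Uq Dp aa bb mulrBl.
Qed.

Lemma rmorph_monomial (R S : comNzRingType) (f : {rmorphism R -> S})
  (a b x y : R) (a' b' x' y' : S) r s :
  f a = a' -> f b = b' -> f x = x' -> f y = y' ->
  f (a * (b * (x ^+ r * y ^+ s))) = a' * (b' * (x' ^+ r * y' ^+ s)).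
Proof. by move=> <- <- <- <-; rewrite !rmorphM !rmorphXn. Qed.

(** * Splitting off the variables x_i and x_j *)

Section OffVariables.
Variables (K : idomainType) (n : nat) (i j : 'I_n).
Hypothesis hij : i != j.
Local Notation P := {mpoly K[n]}.
Implicit Types (f g : P).

(* The coefficients stay in the whole ring, although they never involve x_i, x_j.
   Locking stops unification from unfolding [mmap] down to coefficients. *)
Definition to_bipoly : {rmorphism P -> {poly {poly P}}} :=
  locked (mmap (polyC \o (polyC \o @mpolyC n K))
    (fun k => if k == i then 'X%:P else if k == j then 'X else ('X_k)%:P%:P) : {rmorphism P -> {poly {poly P}}}).

Definition of_bipoly : {rmorphism {poly {poly P}} -> P} :=
  locked (horner_eval 'X_i \o horner_eval ('X_j)%:P : {rmorphism {poly {poly P}} -> P}).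

(** Reduction modulo the prime generated by x_i and x_j, realized as a retraction onto the
    polynomials in the other variables. *)
Definition subst0 : {rmorphism P -> P} := horner_eval 0 \o (horner_eval 0 \o to_bipoly).

Definition offmon (m : 'X_{1..n}) : P :=
  \prod_(k < n | (k != i) && (k != j)) 'X_k ^+ m k.

Lemma to_bipolyXi : to_bipoly 'X_i = 'X%:P.
Proof. by rewrite /to_bipoly -lock [LHS]mmapX mmap1U eqxx. Qed.

Lemma to_bipolyXj : to_bipoly 'X_j = 'X.
Proof. by rewrite /to_bipoly -lock [LHS]mmapX mmap1U eqxx eq_sym (negPf hij). Qed.

Lemma of_bipolyC f : of_bipoly f%:P%:P = f.
Proof. by rewrite /of_bipoly -lock /= /horner_eval !hornerC. Qed.

Lemma of_bipolyXi : of_bipoly 'X%:P = 'X_i.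
Proof. by rewrite /of_bipoly -lock /= /horner_eval hornerC hornerX. Qed.

Lemma of_bipolyXj : of_bipoly 'X = 'X_j.
Proof. by rewrite /of_bipoly -lock /= /horner_eval hornerX hornerC. Qed.

Lemma mpolyX_split m : 'X_[m] = offmon m * ('X_i ^+ m i * 'X_j ^+ m j) :> P.
Proof.
rewrite mpolyXE_id (bigD1 i) //= (bigD1 j) 1?eq_sym //=.
by rewrite /offmon mulrA mulrC.
Qed.

Lemma to_bipoly_offvar k : k != i -> k != j -> to_bipoly 'X_k = ('X_k)%:P%:P.
Proof. by move=> ki kj; rewrite /to_bipoly -lock [LHS]mmapX mmap1U (negPf ki) (negPf kj). Qed.

Lemma to_bipoly_offmon m : to_bipoly (offmon m) = (offmon m)%:P%:P.
Proof.
rewrite /offmon !rmorph_prod; apply: eq_bigr => k /andP[ki kj].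
by rewrite !rmorphXn /= to_bipoly_offvar.
Qed.

Lemma mpoly_monomial_ind (D : P -> Prop) : D 0 -> (forall f g, D f -> D g -> D (f + g)) ->
  (forall c m, D (c%:MP * (offmon m * ('X_i ^+ m i * 'X_j ^+ m j)))) -> forall f, D f.
Proof.
move=> D0 DD DX f; rewrite [f]mpolyE; elim/big_ind: _ => // m _.
by rewrite -mul_mpolyC mpolyX_split; apply: DX.
Qed.

Lemma to_bipolyC c : to_bipoly c%:MP = c%:MP%:P%:P.
Proof. by rewrite /to_bipoly -lock [LHS]mmapC. Qed.

Lemma to_bipoly_monomial c m r s : to_bipoly (c%:MP * (offmon m * ('X_i ^+ r * 'X_j ^+ s))) =
  c%:MP%:P%:P * ((offmon m)%:P%:P * ('X%:P ^+ r * 'X ^+ s)).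
Proof. exact: (rmorph_monomial _ _ (to_bipolyC c) (to_bipoly_offmon m) to_bipolyXi to_bipolyXj). Qed.

(** Only a one-sided inverse: [of_bipoly] also identifies x_i among the coefficients with the inner
    variable. *)
Lemma to_bipolyK f : of_bipoly (to_bipoly f) = f.
Proof.
elim/mpoly_monomial_ind: f => [|f g E1 E2|c m]; first by rewrite 2!rmorph0.
  by rewrite 2!rmorphD E1 E2.
rewrite (to_bipoly_monomial c m).
exact: (rmorph_monomial _ _ (of_bipolyC _) (of_bipolyC _) of_bipolyXi of_bipolyXj).
Qed.

Lemma subst0E f : subst0 f = (to_bipoly f).[0].[0].
Proof. by unlock subst0. Qed.

(** The hypothesis is the form in which absence of x_i and x_j from [f] is expressed throughout. *)
Lemma subst0_const f : to_bipoly f = f%:P%:P -> subst0 f = f.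
Proof. by rewrite subst0E => ->; rewrite !hornerC. Qed.

Lemma subst0_Xi : subst0 'X_i = 0.
Proof. by rewrite subst0E to_bipolyXi hornerC hornerX. Qed.

Lemma subst0_Xj : subst0 'X_j = 0.
Proof. by rewrite subst0E to_bipolyXj hornerX hornerC. Qed.

Lemma subst0_monomial c m r s : subst0 (c%:MP * (offmon m * ('X_i ^+ r * 'X_j ^+ s))) =
  if (r + s == 0)%N then c%:MP * offmon m else 0.
Proof.
rewrite (rmorph_monomial _ _ (subst0_const (to_bipolyC c))
  (subst0_const (to_bipoly_offmon m)) subst0_Xi subst0_Xj).
by case: r s => [|r] [|s]; rewrite ?expr0n ?expr0 ?mul0r ?mulr1 ?mulr0.
Qed.

Lemma to_bipoly_subst0 f : to_bipoly (subst0 f) = (subst0 f)%:P%:P.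
Proof.
elim/mpoly_monomial_ind: f => [|f g E1 E2|c m]; first by rewrite 2!rmorph0 !polyC0.
  by rewrite 2!rmorphD E1 E2 !polyCD.
rewrite subst0_monomial; case: eqP => _; last by rewrite rmorph0 !polyC0.
by rewrite rmorphM to_bipolyC to_bipoly_offmon -!polyCM.
Qed.

Definition idealij : P -> Prop := ideal_gen (fun f => f = 'X_i \/ f = 'X_j).

Lemma idealijE f : idealij f <-> exists g1 g2, f = g1 * 'X_i + g2 * 'X_j.
Proof.
split; last first.
  move=> [g1 [g2 ->]]; have [_ QD _] := ideal_gen_closed (fun f : P => f = 'X_i \/ f = 'X_j).
  by apply: QD; apply: ideal_genM; [left | right].
apply: (ideal_gen_min (J := fun f => exists g1 g2, f = g1 * 'X_i + g2 * 'X_j)).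
  split; first by exists 0, 0; rewrite !mul0r addr0.
    by move=> _ _ [g1 [g2 ->]] [h1 [h2 ->]]; exists (g1 + h1), (g2 + h2); ring.
  by move=> r _ [g1 [g2 ->]]; exists (r * g1), (r * g2); ring.
by move=> g [->|->]; [exists 1, 0 | exists 0, 1]; ring.
Qed.

Lemma idealij_sub_subst0 f : idealij (f - subst0 f).
Proof.
have [Q0 QD QM] := ideal_gen_closed (fun f : P => f = 'X_i \/ f = 'X_j).
elim/mpoly_monomial_ind: f => [|f g E1 E2|c m]; first by rewrite rmorph0 subr0.
  by rewrite rmorphD opprD addrACA; apply: QD.
rewrite subst0_monomial; case: eqP => [|rs].
  by case: (m i) (m j) => [|r] [|s] // _; rewrite !expr0 !mulr1 subrr.
rewrite subr0; do 2!apply: (QM); case: (m i) (m j) rs => [|r] s rs.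
  case: s rs => [|s] rs; first by case: rs.
  by rewrite exprSr mulrA; apply: ideal_genM; right.
by rewrite mulrC exprSr mulrA; apply: ideal_genM; left.
Qed.

Lemma idealij_subst0 f : idealij f <-> subst0 f = 0.
Proof.
split=> [/idealijE [g1 [g2 ->]]|f0]; last by have := idealij_sub_subst0 f; rewrite f0 subr0.
by rewrite rmorphD 2!rmorphM subst0_Xi subst0_Xj !mulr0 addr0.
Qed.

End OffVariables.

(** * The primary component *)

Lemma rmorph_binomial (R S : comNzRingType) (f : {rmorphism R -> S})
  (a b x y : R) (a' b' x' y' : S) r s :
  f a = a' -> f b = b' -> f x = x' -> f y = y' ->
  f (a * x ^+ r - b * y ^+ s) = a' * x' ^+ r - b' * y' ^+ s.
Proof. by move=> <- <- <- <-; rewrite rmorphB !rmorphM !rmorphXn. Qed.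

Lemma rmorph_binomial0 (R S : comNzRingType) (f : {rmorphism R -> S}) (a b x y : R) r s :
  (0 < r)%N -> (0 < s)%N -> f x = 0 -> f y = 0 -> f (a * x ^+ r - b * y ^+ s) = 0.
Proof.
move=> r0 s0 fx fy; rewrite rmorphB !rmorphM !rmorphXn fx fy !expr0n.
by rewrite !gtn_eqF // !mulr0 subrr.
Qed.

Section Component.
Variables (K : idomainType) (n : nat) (i j : 'I_n).
Hypothesis hij : i != j.
Local Notation P := {mpoly K[n]}.
Local Notation to_bipoly := (to_bipoly K i j).
Local Notation of_bipoly := (of_bipoly K i j).
Local Notation subst0 := (subst0 K i j).
Local Notation idealij := (@idealij K n i j).
Implicit Types (f g h : P).

Variables (d l p q : nat).
Hypotheses (d0 : (0 < d)%N) (l0 : (0 < l)%N) (p0 : (0 < p)%N) (q0 : (0 < q)%N).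
Hypothesis cpq : coprime p q.

(** * The ideal of the monomials of (X, Z)-degree [p + q - 1] *)

Variables (N : nat) (ej : nat -> nat).
Hypotheses (NE : N = (p + q - 1)%N) (eE : forall k, ej k = (l * (p + q - 1 - k))%N).

Definition stair : P -> Prop := ideal_gen (fun f => exists2 k : nat,
  (k <= N)%N & f = 'X_i ^+ (k * d) * 'X_j ^+ ej k).

Lemma stair_closed : ideal_closed stair.
Proof. exact: ideal_gen_closed. Qed.

Lemma stairX g a b : (p + q - 1 <= a %/ d + b %/ l)%N -> stair (g * ('X_i ^+ a * 'X_j ^+ b)).
Proof.
(* Capping the X-degree at [p + q - 1] selects a generator that divides the monomial. *)
move=> hab; pose k := minn (a %/ d) (p + q - 1).
have ka : (k * d <= a)%N.
  by apply: leq_trans (leq_trunc_div a d); rewrite leq_pmul2r // geq_minl.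
have kb : (l * (p + q - 1 - k) <= b)%N.
  apply: leq_trans (leq_trunc_div b l); rewrite mulnC leq_pmul2r // /k.
  by move: (a %/ d)%N (b %/ l)%N hab => u v; lia.
rewrite -(subnK ka) -(subnK kb) !exprD.
set x := 'X_i; set y := 'X_j; set u := (_ ^+ (a - _)); set v := (_ ^+ (b - _)).
have -> : g * (u * x ^+ (k * d) * (v * y ^+ (l * (p + q - 1 - k)))) =
   g * (u * v) * (x ^+ (k * d) * y ^+ (l * (p + q - 1 - k))) by ring.
by apply: ideal_genM; exists k; rewrite ?eE // NE geq_minr.
Qed.

Local Notation tr := (wtrunc d l (p + q - 1)).

Lemma trunc_stair f : stair f -> tr (to_bipoly f) = 0.
Proof.
move=> [s [sS ->]]; rewrite rmorph_sum.
elim: s sS => [|r s IH] sS.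
  by rewrite big_nil; apply: bipolyP => b a; rewrite coef_wtrunc !coef0 if_same.
rewrite big_cons wtruncD IH ?addr0; last by move=> t ts; apply: sS; rewrite inE ts orbT.
have [k kl ->] := sS r (mem_head _ _); rewrite NE in kl; rewrite eE.
rewrite rmorphM (rmorphM to_bipoly) 2!(rmorphXn to_bipoly) to_bipolyXi to_bipolyXj // mulrC [(k * d)%N]mulnC wtruncXXM //.
have -> : (p + q - 1 - (k + (p + q - 1 - k)) = 0)%N by lia.
rewrite (_ : wtrunc _ _ _ _ = 0) ?mulr0 //.
by apply: bipolyP => b a; rewrite coef_wtrunc ltn0 !coef0.
Qed.

(** The discarded terms have degree at least [p + q - 1], so truncation picks a representative
    modulo [stair]. *)
Lemma sub_trunc_stair f : stair (f - of_bipoly (tr (to_bipoly f))).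
Proof.
rewrite -{1}(to_bipolyK hij f) -rmorphB; set H := to_bipoly f - _.
have HH b a : (a %/ d + b %/ l < p + q - 1)%N -> H`_b`_a = 0.
  by move=> hab; rewrite /H !coefB coef_wtrunc hab subrr.
rewrite -[H]coefK poly_def rmorph_sum; apply: ideal_closed_sum stair_closed _ => b.
rewrite -[H`_b]coefK poly_def scaler_suml rmorph_sum; apply: ideal_closed_sum stair_closed _ => a.
rewrite -mul_polyC -[H`_b`_a *: 'X^a]mul_polyC polyCM -mulrA (rmorphM of_bipoly) (rmorphM of_bipoly).
rewrite polyC_exp 2!(rmorphXn of_bipoly) of_bipolyC of_bipolyXi of_bipolyXj.
have [hab|hab] := ltnP (a %/ d + b %/ l)%N (p + q - 1).
  by rewrite HH // mul0r; case: stair_closed.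
exact: stairX.
Qed.

Lemma idealij_nilp_stair f : idealij f -> exists t, stair (f ^+ t).
Proof.
(* In each term of the binomial expansion, x_i has exponent at least [d * (p + q)] or x_j has
   exponent at least [l * (p + q)]. *)
move=> /idealijE [g1 [g2 ->]]; exists (d * (p + q) + l * (p + q))%N.
rewrite exprDn; apply: ideal_closed_sum stair_closed _ => -[t /= tN].
rewrite -mulr_natl; have [_ _ MM] := stair_closed; apply: (MM).
set r := (d * (p + q) + l * (p + q))%N in tN *.
rewrite !exprMn mulrACA; apply: stairX.
have [h|h] := leqP (d * (p + q)) (r - t).
  have : ((p + q) <= (r - t) %/ d)%N by rewrite leq_divRL // mulnC.
  by move: (_ %/ d)%N (_ %/ l)%N => u v; lia.
have : ((p + q) <= t %/ l)%N by rewrite leq_divRL // mulnC; lia.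
by move: (_ %/ d)%N (_ %/ l)%N => u v; lia.
Qed.

(** * The saturation plus the monomial ideal, and its local description *)

Variables (m1 n1 m2 n2 Y b1 b2 : P).
Hypotheses (m1C : to_bipoly m1 = m1%:P%:P) (n1C : to_bipoly n1 = n1%:P%:P)
           (m2C : to_bipoly m2 = m2%:P%:P) (n2C : to_bipoly n2 = n2%:P%:P)
           (YC : to_bipoly Y = Y%:P%:P).
Hypothesis Y0 : Y != 0.
Hypotheses (n1Y : exists c z, z * n1 = Y ^+ c) (m2Y : exists c z, z * m2 = Y ^+ c).
Let w := n1 ^+ q * m2 ^+ p - m1 ^+ q * n2 ^+ p.
Hypothesis w0 : w != 0.
Hypotheses (b1E : b1 = m1 * 'X_i ^+ (d * p) - n1 * 'X_j ^+ (l * p))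
           (b2E : b2 = m2 * 'X_i ^+ (d * q) - n2 * 'X_j ^+ (l * q)).
Hypotheses (b1_1 : b1.@[fun=> 1] = 0) (b2_1 : b2.@[fun=> 1] = 0) (Y_1 : Y.@[fun=> 1] = 1).
Variable I : P -> Prop.
Hypothesis IE : forall f, I f <-> exists A B, f = A * b1 + B * b2.

Let J := ideal_sum (saturation I Y) stair.

Lemma to_bipoly_b1 : to_bipoly b1 = biform d l m1 n1 p.
Proof.
rewrite b1E (rmorph_binomial _ _ m1C n1C (to_bipolyXi K i j) (to_bipolyXj K hij)).
by [].
Qed.

Lemma to_bipoly_b2 : to_bipoly b2 = biform d l m2 n2 q.
Proof.
rewrite b2E (rmorph_binomial _ _ m2C n2C (to_bipolyXi K i j) (to_bipolyXj K hij)).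
by [].
Qed.

Lemma generators_closed : ideal_closed I.
Proof.
split; first by apply/IE; exists 0, 0; rewrite !mul0r addr0.
  move=> f g /IE [A [B ->]] /IE [A' [B' ->]]; apply/IE.
  by exists (A + A'), (B + B'); ring.
by move=> r f /IE [A [B ->]]; apply/IE; exists (r * A), (r * B); ring.
Qed.

Lemma saturation_component f : saturation I Y f -> J f.
Proof. by move=> h; exists f, 0; rewrite addr0; split=> //; split=> //; case: stair_closed. Qed.

Lemma generators_component f : I f -> J f.
Proof. by move=> h; apply: saturation_component; exists 0%N; rewrite expr0 mul1r. Qed.

Lemma stair_component f : stair f -> J f.
Proof.
move=> h; exists 0, f; rewrite add0r; split=> //; exists 0%N; rewrite mulr0.
by case: generators_closed.
Qed.

Lemma component_closed : ideal_closed J.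
Proof.
have [I0 ID IM] := generators_closed; have [M0 MD MM] := stair_closed.
split; first exact: generators_component.
  move=> _ _ [f [m [[c If] [Mm ->]]]] [f' [m' [[c' If'] [Mm' ->]]]].
  exists (f + f'), (m + m'); split; last by split; [exact: MD | ring].
  exists (c + c')%N.
  have -> : Y ^+ (c + c') * (f + f') = Y ^+ c' * (Y ^+ c * f) + Y ^+ c * (Y ^+ c' * f').
    by rewrite exprD; ring.
  by apply: ID; apply: IM.
move=> r _ [f [m [[c If] [Mm ->]]]]; exists (r * f), (r * m); split; last first.
  by split; [exact: MM | ring].
by exists c; rewrite mulrCA; apply: IM.
Qed.

(** The saturation by [Y] seen in the bivariate ring; [A] and [B] need not be images under
    [to_bipoly]. *)
Definition bisat (G : {poly {poly P}}) := exists e A B,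
  (Y ^+ e)%:P%:P * G = biform d l m1 n1 p * A + biform d l m2 n2 q * B.

Lemma bisat_saturation G : bisat G -> saturation I Y (of_bipoly G).
Proof.
move=> [e [A [B E]]]; exists e; apply/IE; exists (of_bipoly A), (of_bipoly B).
have := congr1 of_bipoly E; rewrite -to_bipoly_b1 -to_bipoly_b2 (rmorphM of_bipoly) of_bipolyC rmorphD.
by rewrite 2!(rmorphM of_bipoly) !(to_bipolyK hij) [b1 * _]mulrC [b2 * _]mulrC.
Qed.

(* Both generators are homogeneous in (X, Z), so truncation preserves the saturation. *)
Lemma component_trunc f : J f <-> bisat (tr (to_bipoly f)).
Proof.
split=> [[g [m [[c /IE [A [B Ig]]] [Mm ->]]]]|/bisat_saturation h]; last first.
  exists (of_bipoly (tr (to_bipoly f))), (f - of_bipoly (tr (to_bipoly f))); split=> //.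
  by split; [exact: sub_trunc_stair | ring].
rewrite rmorphD wtruncD (trunc_stair Mm) addr0.
have := congr1 (fun z => tr (to_bipoly z)) Ig; rewrite /= rmorphD 3!(rmorphM to_bipoly).
rewrite (rmorphXn to_bipoly) YC -!polyC_exp wtruncCM wtruncD to_bipoly_b1 to_bipoly_b2.
rewrite ![to_bipoly _ * biform _ _ _ _ _]mulrC !wtrunc_biformM // => E.
by exists c; eexists; eexists; exact: E.
Qed.

(** Truncation commutes with multiplication by [h], so [biform_torsion] applies with the nonzero
    multiplier [Y ^+ e * h]. *)
Lemma component_torsion h f : to_bipoly h = h%:P%:P -> h != 0 -> J (h * f) -> J f.
Proof.
move=> hC h0 /component_trunc [e [A [B E]]]; apply/component_trunc.
move: E; rewrite (rmorphM to_bipoly) hC wtruncCM mulrA -!polyCM => E.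
by apply: biform_torsion E => //; rewrite mulf_neq0 // expf_neq0.
Qed.

Lemma cross_binomial_stair f : stair f -> I (w * f).
Proof.
have [I0 ID IM] := generators_closed.
apply: (ideal_gen_min (J := fun f => I (w * f))).
  split; first by rewrite mulr0.
    by move=> g h Ig Ih; rewrite mulrDr; apply: ID.
  by move=> r g Ig; rewrite mulrCA; apply: IM.
move=> _ [k kl ->]; rewrite NE in kl; rewrite eE [(k * d)%N]mulnC !exprM.
have h1 : I (m1 * ('X_i ^+ d) ^+ p - n1 * ('X_j ^+ l) ^+ p).
  by rewrite -!exprM -b1E; apply/IE; exists 1, 0; ring.
have h2 : I (m2 * ('X_i ^+ d) ^+ q - n2 * ('X_j ^+ l) ^+ q).
  by rewrite -!exprM -b2E; apply/IE; exists 0, 1; ring.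
by apply: (cycle_mem generators_closed h1 h2) => //; lia.
Qed.

Lemma subst0_cross_binomial : subst0 w = w.
Proof.
apply: subst0_const; rewrite /w rmorphB 2!(rmorphM to_bipoly) 4!(rmorphXn to_bipoly) m1C n1C m2C n2C.
by rewrite polyCB polyCB !polyCM !polyC_exp.
Qed.

Lemma generators_idealij f : I f -> idealij f.
Proof.
move=> /IE [A [B ->]]; apply/(idealij_subst0 hij).
have s1 : subst0 b1 = 0.
  rewrite b1E; apply: rmorph_binomial0 (subst0_Xi K i j) (subst0_Xj K hij).
    by rewrite muln_gt0 d0.
  by rewrite muln_gt0 l0.
have s2 : subst0 b2 = 0.
  rewrite b2E; apply: rmorph_binomial0 (subst0_Xi K i j) (subst0_Xj K hij).
    by rewrite muln_gt0 d0.
  by rewrite muln_gt0 l0.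
by rewrite (rmorphD subst0) 2!(rmorphM subst0) s1 s2 !mulr0 addr0.
Qed.

Lemma component_local f : J f <-> exists s, ~ idealij s /\ I (s * f).
Proof.
have [I0 ID IM] := generators_closed; split.
  (* [Y ^+ c] brings the saturation part into [I] and [w] the monomial part; both are nonzero and
     free of x_i and x_j, so their product avoids the prime. *)
  move=> [g [m [[c Ig] [Mm ->]]]]; exists (Y ^+ c * w); split.
    rewrite (idealij_subst0 hij) (rmorphM subst0) subst0_cross_binomial (rmorphXn subst0) (subst0_const YC).
    by apply/eqP; rewrite mulf_neq0 // expf_neq0.
  rewrite mulrDr; apply: ID; last by rewrite -mulrA; apply/IM/cross_binomial_stair.
  by rewrite mulrAC mulrC; apply: IM.
(* A power of s - s(0, 0) is in the monomial ideal, so s may be replaced by s(0, 0). *)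
move=> [s [Qs Is]]; have [r Mr] := idealij_nilp_stair (idealij_sub_subst0 hij s).
have s0 : subst0 s != 0 by apply/eqP => s0; apply: Qs; apply/(idealij_subst0 hij).
apply: (@component_torsion (subst0 s ^+ r)); first by rewrite (rmorphXn to_bipoly) (to_bipoly_subst0 hij) 2!polyC_exp.
  exact: expf_neq0.
have [J0 JD JM] := component_closed; have [M0 MD MM] := stair_closed.
(* The difference of the two [r]-th powers is a multiple of [s], since the bases differ by [s]. *)
have E := subrXX (subst0 s) (subst0 s - s) r.
rewrite (subKr (subst0 s) s) in E.
move: (\sum_(_ < _) _) E => S E.
have -> : subst0 s ^+ r * f = S * (s * f) + (-1) ^+ r * f * (s - subst0 s) ^+ r.
  have -> : subst0 s ^+ r = s * S + (subst0 s - s) ^+ r by rewrite -E subrK.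
  have -> : (subst0 s - s) ^+ r = (-1) ^+ r * (s - subst0 s) ^+ r by rewrite -exprNn opprB.
  by move: ((-1) ^+ r) ((s - subst0 s) ^+ r) => u v; ring.
by apply: JD; [apply/JM/generators_component | apply/stair_component/MM].
Qed.

Lemma idealij_proper : ~ idealij 1.
Proof. by rewrite (idealij_subst0 hij) rmorph1; apply/eqP; rewrite oner_neq0. Qed.

Lemma idealij_prime f g : idealij (f * g) -> idealij f \/ idealij g.
Proof.
rewrite !(idealij_subst0 hij) (rmorphM subst0) => /eqP; rewrite mulf_eq0 => /orP[/eqP|/eqP]; by [left | right].
Qed.

Lemma component_idealij f : J f -> idealij f.
Proof. by move=> /component_local [s [Qs /generators_idealij /idealij_prime []]]. Qed.

Lemma component_radical f : radical J f <-> idealij f.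
Proof.
split=> [[m /component_idealij]|/idealij_nilp_stair [t /stair_component h]]; last by exists t.
elim: m => [|m IH]; first by rewrite expr0 => /idealij_proper.
by rewrite exprS => /idealij_prime [].
Qed.

Lemma component_primary : primary_component I idealij J.
Proof.
split; [|exact: component_radical|exact: component_local].
split; first by move=> /component_idealij; exact: idealij_proper.
(* Either [g] lies in the prime, which is the radical of [J], or it can be absorbed into the
   multiplier [s]. *)
move=> f g Jfg; have [g0|g0] := eqVneq (subst0 g) 0.
  by right; apply/component_radical/idealij_subst0.
left; move/component_local: Jfg => [s [Qs Is]]; apply/component_local; exists (s * g); split.
  by move=> /idealij_prime [//|/(idealij_subst0 hij)]; apply/eqP.
by rewrite -mulrA [g * f]mulrC.
Qed.

Lemma component_monomial u : J 'X_[u] <-> stair 'X_[u].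
Proof.
split; last exact: stair_component.
move=> Ju; have [hu|hu] := leqP (p + q - 1) (u i %/ d + u j %/ l).
  by rewrite (mpolyX_split _ hij); apply: stairX.
have tru : tr (to_bipoly 'X_[u]) = to_bipoly 'X_[u].
  have -> : to_bipoly 'X_[u] = (offmon K i j u)%:P%:P * ('X%:P ^+ u i * 'X ^+ u j * 1).
    rewrite mulr1 (mpolyX_split _ hij) 2!(rmorphM to_bipoly) 2!(rmorphXn to_bipoly).
    by rewrite to_bipoly_offmon to_bipolyXi to_bipolyXj.
  apply: bipolyP => b a; rewrite coef_wtrunc; case: ltnP => // hab.
  rewrite coefCCM coefXXM !coef1; case: ifP => [/andP[ua ub]|_]; last by rewrite mulr0.
  case: eqP => [b0|_]; last by rewrite coef0 mulr0.
  rewrite coef1; case: eqP => [a0|_]; last by rewrite mulr0.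
  have bu : b = u j by lia.
  have au : a = u i by lia.
  by move: hab; rewrite bu au leqNgt hu.
move/component_trunc: Ju; rewrite tru => /bisat_saturation; rewrite to_bipolyK // => -[c /IE [A [B E]]].
(* At the all-ones point the generators vanish while [Y] and the monomial take the value 1. *)
have := congr1 (meval (fun=> 1)) E.
rewrite mevalD !mevalM b1_1 b2_1 !mulr0 addr0 rmorphXn /= Y_1 mevalX.
rewrite expr1n mul1r big1 => [/eqP|k _]; last exact: expr1n.
by rewrite oner_eq0.
Qed.

End Component.

(** * Lattice basis ideals *)

Lemma mpolyX_inj (R : comNzRingType) (n : nat) (u v : 'X_{1..n}) :
  'X_[u] = 'X_[v] :> {mpoly R[n]} -> u = v.
Proof.
move=> /(congr1 (mcoeff u)); rewrite !mcoeffX eqxx; case: eqP => // _ /eqP.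
by rewrite oner_eq0.
Qed.

Lemma mpolyX_neq0 (R : comNzRingType) (n : nat) (u : 'X_{1..n}) : 'X_[u] != 0 :> {mpoly R[n]}.
Proof.
apply/eqP => /(congr1 (mcoeff u)) /eqP; rewrite mcoeffX eqxx mcoeff0.
by rewrite oner_eq0.
Qed.

Definition offmnm n (i j : 'I_n) (m : 'X_{1..n}) : 'X_{1..n} :=
  [multinom (if (k != i) && (k != j) then m k else 0%N) | k < n].

Lemma offmonE (K : idomainType) n (i j : 'I_n) (m : 'X_{1..n}) :
  offmon K i j m = 'X_[offmnm i j m].
Proof.
rewrite mpolyXE_id /offmon big_mkcond /=; apply: eq_bigr => k _.
by rewrite mnmE; case: ifP => // _; rewrite expr0.
Qed.

Lemma offmon_dvd (K : idomainType) n (i j : 'I_n) (m : 'X_{1..n}) :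
  exists c z, z * offmon K i j m = (\prod_(k < n | (k != i) && (k != j)) 'X_k) ^+ c.
Proof.
(* The largest exponent of [m] suffices; the cofactor fills every other exponent up to it. *)
pose c := (\max_k m k)%N; exists c, (offmon K i j [multinom (c - m k)%N | k < n]).
rewrite /offmon -big_split -prodrXl /=; apply: eq_bigr => k _.
by rewrite mnmE -exprD subnK // /c (leq_bigmax k).
Qed.

Lemma pos_partE n (mu : 'I_n -> int) k : 0 < mu k ->
  pos_part mu k = `|mu k|%N /\ neg_part mu k = 0%N.
Proof. by rewrite /pos_part /neg_part !mnmE; lia. Qed.

Lemma neg_partE n (mu : 'I_n -> int) k : mu k < 0 ->
  pos_part mu k = 0%N /\ neg_part mu k = `|mu k|%N.
Proof. by rewrite /pos_part /neg_part !mnmE; lia. Qed.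

(** The opposite signs at [i] and [j] confine x_i to the first monomial and x_j to the second. *)
Lemma binom_split (K : idomainType) n (i j : 'I_n) (mu : 'I_n -> int) (r s : nat) :
  i != j -> 0 < mu i -> mu j < 0 -> `|mu i|%N = r -> `|mu j|%N = s ->
  binom K mu = offmon K i j (pos_part mu) * 'X_i ^+ r - offmon K i j (neg_part mu) * 'X_j ^+ s.
Proof.
move=> hij /pos_partE [pi ni] /neg_partE [pj nj] <- <-.
by rewrite /binom (mpolyX_split K hij (pos_part mu)) (mpolyX_split K hij (neg_part mu)) pi ni pj nj !expr0 mulr1 mul1r.
Qed.

Lemma binom_at1 (K : comNzRingType) n (mu : 'I_n -> int) : (binom K mu).@[fun=> 1] = 0.
Proof.
rewrite /binom mevalB !mevalX !big1 ?subrr // => k _; exact: expr1n.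
Qed.

Lemma rank2_indep n (B : 'M[int]_(n, 2)) (s t : int) :
  \rank (map_mx (fun z : int => z%:~R : rat) B) = 2%N ->
  (forall k, s * B k ord0 = t * B k ord_max) -> s = 0.
Proof.
set M := map_mx _ B => rk E.
(* The relation puts [(s, -t)] in the kernel of a matrix of full column rank. *)
pose u : 'cV[rat]_2 := \col_k (if k == ord0 then s%:~R else - t%:~R).
have Mu : M *m u = 0.
  apply/matrixP => k c; rewrite !mxE big_ord_recl big_ord1 !mxE /=.
  have -> : lift ord0 ord0 = ord_max :> 'I_2 by apply: val_inj.
  by rewrite mulrN -!intrM [B k ord0 * _]mulrC [B k ord_max * _]mulrC E subrr.
have := mulmx0_rank_max Mu; rewrite rk => h.
have /eqP : \rank u = 0%N by lia.
rewrite mxrank_eq0 => /eqP u0.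
by have := congr1 (fun F : 'cV[rat]_2 => F ord0 ord0) u0; rewrite !mxE /= => /eqP; rewrite intr_eq0 => /eqP.
Qed.

Lemma lattice_basis_idealE (K : comNzRingType) n (B : 'M[int]_(n, 2)) f :
  lattice_basis_ideal B f <-> exists A C : {mpoly K[n]},
    f = A * binom K (fun k => B k ord0) + C * binom K (fun k => B k ord_max).
Proof.
split; last first.
  move=> [A [C ->]].
  have [_ ID _] := ideal_gen_closed
    (fun f : {mpoly K[n]} => exists c : 'I_2, f = binom K (fun k => B k c)).
  by apply: ID; apply: ideal_genM; eexists.
apply: (ideal_gen_min (J := fun f => exists A C, f = A * _ + C * _)).
  split; first by exists 0, 0; rewrite !mul0r addr0.
    by move=> _ _ [A [C ->]] [A' [C' ->]]; exists (A + A'), (C + C'); ring.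
  by move=> r _ [A [C ->]]; exists (r * A), (r * C); ring.
move=> _ [c ->]; have [->|->] : c = ord0 \/ c = ord_max.
- by case: c => [[|[|c]] hc] //; [left | right]; apply: val_inj.
- by exists 1, 0; rewrite mul1r mul0r addr0.
- by exists 0, 1; rewrite mul1r mul0r add0r.
Qed.

(** If the two monomials were equal, comparing exponents would make [q] times the first column equal
    to [p] times the second off rows [i] and [j]. Those rows satisfy it too, against rank 2. *)
Lemma cross_binomial_neq0 (K : idomainType) n (B : 'M[int]_(n, 2)) (i j : 'I_n) (p q : nat) :
  \rank (map_mx (fun z : int => z%:~R : rat) B) = 2%N -> (0 < q)%N ->
  q%:Z * B i ord0 = p%:Z * B i ord_max -> q%:Z * B j ord0 = p%:Z * B j ord_max ->
  let pos c := offmon K i j (pos_part (fun k => B k c)) in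
  let neg c := offmon K i j (neg_part (fun k => B k c)) in
  neg ord0 ^+ q * pos ord_max ^+ p - pos ord0 ^+ q * neg ord_max ^+ p <> 0.
Proof.
move=> rk q0 Ei Ej pos neg /eqP; rewrite subr_eq0 /pos /neg !offmonE !mpolyXn -!mpolyXD.
move=> /eqP /mpolyX_inj E.
have : q%:Z = 0; last by lia.
apply: (rank2_indep (t := p%:Z) rk) => k.
have [->//|ki] := eqVneq k i; have [->//|kj] := eqVneq k j.
have := congr1 (fun m : 'X_{1..n} => m k) E.
by rewrite !mnmDE !mulmnE !mnmE ki kj /=; nia.
Qed.

Theorem theorem5p1 (K : closedFieldType) (n : nat) (B : 'M[int]_(n, 2))
  (i j : 'I_n) :
  [pchar K] =i pred0 ->
  \rank (map_mx (fun z : int => z%:~R : rat) B) = 2%N ->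
  i != j ->
  0 < B i ord0 -> 0 < B i ord_max -> B j ord0 < 0 -> B j ord_max < 0 ->
  B i ord0 * B j ord_max = B i ord_max * B j ord0 ->
  let a1 := `|B i ord0|%N in
  let a2 := `|B i ord_max|%N in
  let c1 := `|B j ord0|%N in
  let d := gcdn a1 a2 in
  (* e k = lambda * (b_i1 + b_i2 - (k+1) d), lambda = -b_j1 / b_i1 *)
  let e := fun k : nat => ((c1 * (a1 + a2 - k.+1 * d)) %/ a1)%N in
  let I := @lattice_basis_ideal n K B in
  let Mon := ideal_gen (fun f : {mpoly K[n]} => exists2 k : nat,
                (k <= (a1 + a2 - d) %/ d)%N &
                f = 'X_i ^+ (k * d) * 'X_j ^+ e k) in
  let J := ideal_sum (saturation I (\prod_(k < n | (k != i) && (k != j)) 'X_k))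
                     Mon in
  primary_component I (ideal_gen (fun f => f = 'X_i \/ f = 'X_j)) J /\
  (forall u : 'X_{1..n}, J 'X_[u] <-> Mon 'X_[u]).
Proof.
move=> _ rk hij Bi0 Bi1 Bj0 Bj1 det a1 a2 c1 d e I M J.
have a1_gt0 : (0 < a1)%N by rewrite /a1; lia.
have a2_gt0 : (0 < a2)%N by rewrite /a2; lia.
have d0 : (0 < d)%N by rewrite gcdn_gt0 a1_gt0.
pose p := (a1 %/ d)%N; pose q := (a2 %/ d)%N; pose c2 := `|B j ord_max|%N.
have a1E : a1 = (d * p)%N by rewrite mulnC divnK // dvdn_gcdl.
have a2E : a2 = (d * q)%N by rewrite mulnC divnK // dvdn_gcdr.
have p0 : (0 < p)%N by move: a1_gt0; rewrite a1E muln_gt0 => /andP[].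
have q0 : (0 < q)%N by move: a2_gt0; rewrite a2E muln_gt0 => /andP[].
have cpq : coprime p q.
  by rewrite /coprime -(eqn_pmul2l d0) muln1 muln_gcdr -a1E -a2E.
have cross : (p * c2 = q * c1)%N.
  apply/eqP; rewrite -(eqn_pmul2l d0) !mulnA -a1E -a2E; apply/eqP.
  by rewrite /a1 /a2 /c1 /c2; nia.
(* This is lambda times [d]. The division is exact because [p] divides [q * c1] and is coprime to
   [q]; row [j] is then [-l] times [(p, q)]. *)
pose l := (c1 %/ p)%N.
have c1E : c1 = (l * p)%N.
  by rewrite divnK // -(Gauss_dvdr _ cpq) -cross dvdn_mulr.
have c2E : c2 = (l * q)%N.
  by apply/eqP; rewrite -(eqn_pmul2l p0) cross c1E mulnCA [(p * _)%N]mulnCA [(q * _)%N]mulnC.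
have l0 : (0 < l)%N by have : (0 < c1)%N; [rewrite /c1; lia | rewrite c1E muln_gt0 => /andP[]].
have NE : ((a1 + a2 - d) %/ d = p + q - 1)%N.
  by rewrite a1E a2E -mulnDr -{2}[d]muln1 -mulnBr mulKn.
(* The quotient defining [e] is exact; for [k] beyond [p + q - 1] both sides are 0 by truncated
   subtraction. *)
have eE k : e k = (l * (p + q - 1 - k))%N.
  rewrite /e; have -> : (c1 * (a1 + a2 - k.+1 * d) = l * (p + q - 1 - k) * a1)%N.
    rewrite {1}a1E a2E -mulnDr [(k.+1 * d)%N]mulnC -mulnBr c1E a1E.
    by have -> : (p + q - k.+1 = p + q - 1 - k)%N by [lia]; nia.
  by rewrite mulnK.
set Y := \prod_(k < n | _) _ in J *.
have YE : Y = offmon K i j [multinom 1%N | k < n].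
  by apply: eq_bigr => k _; rewrite mnmE expr1.
have YC : to_bipoly K i j Y = Y%:P%:P by rewrite YE to_bipoly_offmon.
have Y0 : Y != 0 by rewrite YE offmonE mpolyX_neq0.
have Y1 : Y.@[fun=> 1] = 1.
  by rewrite YE offmonE mevalX big1 // => k _; rewrite expr1n.
have b1E := binom_split K (mu := fun k => B k ord0) hij Bi0 Bj0 a1E c1E.
have b2E := binom_split K (mu := fun k => B k ord_max) hij Bi1 Bj1 a2E c2E.
have crossi : q%:Z * B i ord0 = p%:Z * B i ord_max.
  have : (q * a1 = p * a2)%N by rewrite a1E a2E mulnCA [(q * p)%N]mulnC mulnCA.
  by rewrite /a1 /a2; lia.
have crossj : q%:Z * B j ord0 = p%:Z * B j ord_max.
  by move: cross; rewrite /c1 /c2; lia.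
have /eqP w0 := cross_binomial_neq0 (K := K) rk q0 crossi crossj.
have IE := lattice_basis_idealE (K := K) B.
have m1C := to_bipoly_offmon K i j (pos_part (fun k => B k ord0)).
have n1C := to_bipoly_offmon K i j (neg_part (fun k => B k ord0)).
have m2C := to_bipoly_offmon K i j (pos_part (fun k => B k ord_max)).
have n2C := to_bipoly_offmon K i j (neg_part (fun k => B k ord_max)).
have n1Y := offmon_dvd K i j (neg_part (fun k => B k ord0)).
have m2Y := offmon_dvd K i j (pos_part (fun k => B k ord_max)).
have z1 := binom_at1 K (fun k => B k ord0).
have z2 := binom_at1 K (fun k => B k ord_max).
have compo := component_primary hij d0 l0 p0 q0 cpq NE eE m1C n1C m2C n2C YC Y0 n1Y m2Y w0 b1E b2E IE.
have mono := component_monomial hij d0 l0 p0 q0 cpq NE eE m1C n1C m2C n2C YC Y0 w0 b1E b2E z1 z2 Y1 IE.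
by split; [exact: compo | exact: mono].
Qed.
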